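(* For any $\beta,c\in\mathbb C$, $\beta\notin\{0,2\}$, $c\notin\{0,1\}$, and any $n\in\mathbb N_0$, the following identities for the Meixner polynomials hold: $$\frac{\beta c}{c-1}\,\Delta_nM_n(x;\beta,c)=x\,M_n(x-1;\beta+1,c),$$ $$M_n(x;\beta,c)+\frac{c}{c-1}\Delta_nM_n(x;\beta,c)=\frac{x+\beta}{\beta}\,M_n(x;\beta+1,c),$$ $$M_n(x;\beta,c)+\frac{1}{c-1}\nabla_nM_n(x;\beta,c)=\frac{x+\beta}{\beta}\,M_{n-1}(x;\beta+1,c),$$ $$\frac{c\beta(1-\beta)}{c-1}\,\nabla_\beta M_n(x;\beta,c)=x\,n\,M_{n-1}(x-1;\beta+1,c),$$ $$\frac{\beta(\beta-1)c}{(\beta+n)(c-1)}M_{n+1}(x+1;\beta-1,c)=\left(x+\beta+\frac{\beta(\beta-1)}{(\beta+n)(c-1)}\right)M_n(x;\beta,c)+(x+\beta)\Delta_\beta M_n(x;\beta,c),$$ $$\frac{(\beta-1)(\beta-2)c}{(\beta-1+n)(c-1)}M_{n+1}(x+1;\beta-2,c)=\left(x+\beta-1+\frac{(\beta-1)(\beta-2)}{(\beta-1+n)(c-1)}\right)M_n(x;\beta,c)-\frac{(\beta-1)(\beta-2)}{(\beta-1+n)(c-1)}\nabla_\beta M_n(x;\beta,c),$$ $$\frac{\partial}{\partial c}\left(c^n(\beta)_nM_n(x;\beta,c)\right)=\frac{n(x+\beta)}{c+n+\beta}\,c^n(\beta+1)_n\,M_{n-1}(x;\beta+1,c),$$ $$c(1-\beta)\,c^n(\beta)_n\,\beta\,M_{n+1}(x;\beta-1,c)=c(1-c)\frac{\partial}{\partial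 c}\left(c^n(\beta)_nM_n(x;\beta,c)\right)-\left((c-1)x+n-(n+1)c+c\beta\right)c^n(\beta)_n\,\beta\,M_n(x;\beta,c).$$
   Context: $\mathbb N_0=\{0,1,2,\dots\}$; $(y)_k=y(y+1)\cdots(y+k-1)$. The Meixner polynomials are $M_n(x;\beta,c)={}_2F_1(-n,-x;\beta;1-1/c)=\sum_{j=0}^n\frac{(-n)_j(-x)_j}{(\beta)_j\,j!}(1-1/c)^j$, with the convention that the polynomial of index $-1$ is $0$. The operators are $\Delta_nf(n)=f(n+1)-f(n)$, $\nabla_nf(n)=f(n)-f(n-1)$, $\Delta_\beta f(\beta)=f(\beta+1)-f(\beta)$, $\nabla_\beta f(\beta)=f(\beta)-f(\beta-1)$, the other variables being fixed.
   Formalization: Third identity only for n≥1 (false at n=0 with M_{-1}=0); seventh has denominator c(n+β) instead of c+n+β; eighth has the missing factor β on the derivative term; each identity assumes its Meixner polynomials are defined and its denominators nonzero. *)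

(* Defs.v *)
From HB Require Import structures.
From mathcomp Require Import all_boot all_order all_algebra.
From mathcomp Require Import complex.
From mathcomp Require Import all_classical all_reals all_analysis.

Set Implicit Arguments.
Unset Strict Implicit.
Unset Printing Implicit Defensive.

Import Order.TTheory GRing.Theory Num.Theory.
Import numFieldNormedType.Exports.

Local Open Scope ring_scope.

Definition pochhammer (K : pzRingType) (y : K) (k : nat) : K :=
  \prod_(i < k) (y + i%:R).

(* The index is an integer so that the polynomial of index -1 makes sense:
   it is 0, like every polynomial of negative index. *)
Definition meixner (K : fieldType) (n : int) (x beta c : K) : K :=
  if n is Posz m then
    \sum_(j < m.+1)
      (pochhammer (- m%:R) j * pochhammer (- x) j) / (pochhammer beta j * j`!%:R)
      * (1 - 1 / c) ^+ j
  else 0.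

(* Since a division by 0 has a value here, this records explicitly that no
   denominator (beta)_j in the definition of the n-th polynomial vanishes.
   It holds vacuously for n < 0. *)
Definition meixner_defined (K : fieldType) (n : int) (beta : K) : Prop :=
  forall j : nat, (j%:Z <= n) -> pochhammer beta j != 0.

Definition fwd_diff (T : pzRingType) (V : zmodType) (f : T -> V) (t : T) : V :=
  f (t + 1) - f t.

Definition bwd_diff (T : pzRingType) (V : zmodType) (f : T -> V) (t : T) : V :=
  f t - f (t - 1).

(* The codomain is K^o, i.e. K as a normed module over itself, so that for
   K = R[i] the derivative of this function of c is the complex derivative. *)
Definition scaled_meixner (K : numFieldType) (n : nat) (x beta : K) : K -> K^o :=
  fun c => c ^+ n * pochhammer beta n * meixner n%:Z x beta c.

(* Main.v *)
Require Import Defs.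
From HB Require Import structures.
From mathcomp Require Import all_boot all_order all_algebra.
From mathcomp Require Import complex.
From mathcomp Require Import all_classical all_reals all_analysis.
From mathcomp Require Import ring.

(** The variables n, x and beta are the parameters of a 2F1 and c enters only
    through z = 1 - 1/c, so every identity is a contiguous relation of Gauss
    for 2F1(-n, -x; beta; z).  Read as a polynomial in z, 2F1 has coefficients
    that are products of rising factorials, and three facts about these
    coefficients suffice.

    The Euler operator z d/dz multiplies the j-th coefficient by j, and
    [y * (y+1)_j = (y)_j * (y+j)]; hence n - z d/dz, x - z d/dz and
    beta - 1 + z d/dz each shift one parameter ([euler_index], [euler_x],
    [euler_beta]).  The derivative d/dz shifts all three parameters
    ([meixner_poly_deriv]).  A difference in n or in x is, up to a constant, z times
    a function with shifted parameters ([meixner_poly_diff_index],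
    [meixner_poly_diff_x]).

    Eliminating the Euler operator between two of its shifts gives the contiguous
    relations [meixner_poly_contiguous_x] and [meixner_poly_contiguous_index];
    combining it with the other facts gives the lowering formula
    [meixner_poly_lower] and the raising formulas [meixner_poly_raise] and
    [meixner_poly_raise2].

    The first identity is the difference in n; the second adds the contiguous
    relation in x, and the third is the second at n - 1.  The fourth combines
    the shift of beta with the derivative.  The fifth and the sixth are
    [meixner_raise2] at two values of beta.  Finally
    c d/dc (c^n M_n) = c^n (n M_n + (1 - z) dM_n/dz), which the lowering formula
    evaluates to give the seventh identity, and which the raising formula
    relates to M_(n+1)(x; beta - 1) to give the eighth. *)

Set Implicit Arguments.
Unset Strict Implicit.
Unset Printing Implicit Defensive.

Import Order.TTheory GRing.Theory Num.Theory.
Import numFieldNormedType.Exports.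

Local Open Scope ring_scope.
Local Open Scope complex_scope.

(** * Rising factorials *)

Section Pochhammer.
Variable K : pzRingType.
Implicit Type y : K.

Lemma pochhammer0 y : pochhammer y 0 = 1.
Proof. by rewrite /pochhammer big_ord0. Qed.

Lemma pochhammerSr y k : pochhammer y k.+1 = pochhammer y k * (y + k%:R).
Proof. by rewrite /pochhammer big_ord_recr. Qed.

Lemma pochhammerSl y k : pochhammer y k.+1 = y * pochhammer (y + 1) k.
Proof.
rewrite /pochhammer big_ord_recl addr0; congr (_ * _).
by apply: eq_bigr => i _; rewrite lift0 -natr1 addrAC addrA.
Qed.

(** Both sides are [pochhammer y k.+1], split off at either end.  Multiplying
    (y)_k by y + k is thus, up to the factor y, a shift of the parameter, which is
    what turns the Euler operator into a parameter shift below. *)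
Lemma pochhammer_shift y k :
  y * pochhammer (y + 1) k = pochhammer y k * (y + k%:R).
Proof. by rewrite -pochhammerSl pochhammerSr. Qed.

Lemma pochhammer_oppn_eq0 m j : (m < j)%N -> pochhammer (- m%:R : K) j = 0.
Proof.
elim: j => // j IHj; rewrite ltnS leq_eqVlt pochhammerSr => /predU1P[->|/IHj ->].
  by rewrite addNr mulr0.
by rewrite mul0r.
Qed.

End Pochhammer.

(** * The Meixner polynomial as a polynomial in 1 - 1/c *)

Section MeixnerPoly.
Variable K : numFieldType.
Implicit Types (a x b z c : K) (m n j : nat).

Lemma pochhammer_neq0_le b j n :
  (j <= n)%N -> pochhammer b n != 0 -> pochhammer b j != 0.
Proof.
move=> /subnK <-; elim: (n - j)%N => // i IHi.
by rewrite addSn pochhammerSr mulf_eq0 negb_or => /andP[/IHi].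
Qed.

Lemma meixner_defined_pochhammer n b :
  meixner_defined n%:Z b -> pochhammer b n != 0.
Proof. by apply. Qed.

(** Coefficient of [z ^+ j] in 2F1(a, -x; b; z); the second parameter enters with
    a minus sign so that it is the argument of the Meixner polynomial. *)
Definition hyp_coef a x b j : K :=
  pochhammer a j * pochhammer (- x) j / (pochhammer b j * j`!%:R).

(** The Meixner polynomial read as a polynomial in z = 1 - 1/c rather than in x:
    identities can then be checked coefficient by coefficient, and the
    c-derivative becomes a formal derivative. *)
Definition meixner_poly (n : int) x b : {poly K} :=
  if n is Posz m then \poly_(j < m.+1) hyp_coef (- m%:R) x b j else 0.

Local Notation P := meixner_poly.

Lemma meixnerE (n : int) x b c : meixner n x b c = (P n x b).[1 - 1 / c].
Proof. by case: n => [m|m] /=; rewrite ?horner0 // horner_poly. Qed.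

(** Beyond the degree, [pochhammer (- n%:R) j] vanishes, so one formula covers
    all [j], and polynomials of different index can be compared without
    adjusting summation ranges. *)
Lemma coef_meixner_poly n x b j : (P n x b)`_j = hyp_coef (- n%:R) x b j.
Proof.
rewrite coef_poly ltnS; case: leqP => // n_lt_j.
by rewrite /hyp_coef pochhammer_oppn_eq0 // !mul0r.
Qed.

(** The factor [n%:R] absorbs the case n = 0, in which the polynomial of index
    -1 does not follow the general formula for its coefficients. *)
Lemma coef_meixner_poly_pred n x b j :
  n%:R * (P (n%:Z - 1) x b)`_j = n%:R * hyp_coef (1 - n%:R) x b j.
Proof.
case: n => [|n]; first by rewrite !mul0r.
by rewrite intS addrAC subrr add0r coef_meixner_poly -natr1 opprD addrCA subrr addr0.
Qed.

Lemma coefX_deriv (p : {poly K}) j : ('X * p^`())`_j = j%:R * p`_j.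
Proof.
by case: j => [|j]; rewrite coefXM ?mul0r // coef_deriv mulr_natl.
Qed.

(** * Action of the Euler operator z d/dz *)

(** The Euler operator multiplies the coefficient of [z ^+ j] by [j], and
    [n - j] times (-n)_j is [n] times (1-n)_j.  The next two lemmas use the same
    mechanism for the other two parameters. *)
Lemma euler_index n x b z :
  n%:R * (P n x b).[z] - z * (P n x b)^`().[z]
  = n%:R * (P (n%:Z - 1) x b).[z].
Proof.
have /(congr1 (horner^~ z)) : n%:R *: P n x b - 'X * (P n x b)^`() =
    n%:R *: P (n%:Z - 1) x b.
  apply/polyP => j; rewrite coefB !coefZ coefX_deriv coef_meixner_poly_pred.
  rewrite coef_meixner_poly /hyp_coef.
  have := pochhammer_shift (- n%:R : K) j; rewrite [- _ + 1]addrC => e.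
  have -> : n%:R * (pochhammer (1 - n%:R) j * pochhammer (- x) j
            / (pochhammer b j * j`!%:R)) = - (- n%:R * pochhammer (1 - n%:R) j)
      * pochhammer (- x) j / (pochhammer b j * j`!%:R) by ring.
  by rewrite e; ring.
by rewrite !hornerE.
Qed.

Lemma euler_x n x b z :
  x * (P n x b).[z] - z * (P n x b)^`().[z] = x * (P n (x - 1) b).[z].
Proof.
have /(congr1 (horner^~ z)) : x *: P n x b - 'X * (P n x b)^`() =
    x *: P n (x - 1) b.
  apply/polyP => j; rewrite coefB !coefZ coefX_deriv !coef_meixner_poly /hyp_coef.
  have := pochhammer_shift (- x) j.
  rewrite [- (x - 1)]opprB [- x + 1]addrC => e.
  have -> : x * (pochhammer (- n%:R) j * pochhammer (1 - x) j
            / (pochhammer b j * j`!%:R)) = - (- x * pochhammer (1 - x) j)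
      * pochhammer (- n%:R) j / (pochhammer b j * j`!%:R) by ring.
  by rewrite e; ring.
by rewrite !hornerE.
Qed.

(** A denominator parameter moves in the opposite direction.  The
    condition on (b)_(n+1) = b (b+1)_n makes the coefficients of both sides
    genuine fractions up to [j = n]. *)
Lemma euler_beta n x b z : pochhammer b n.+1 != 0 ->
  b * (P n x (b + 1)).[z] + z * (P n x (b + 1))^`().[z] = b * (P n x b).[z].
Proof.
move=> bn; have /(congr1 (horner^~ z)) :
    b *: P n x (b + 1) + 'X * (P n x (b + 1))^`() = b *: P n x b.
  apply/polyP => j; rewrite coefD !coefZ coefX_deriv !coef_meixner_poly /hyp_coef.
  have [le_jn|lt_nj] := leqP j n; last by rewrite pochhammer_oppn_eq0 //; ring.
  have bj1 : pochhammer b j.+1 != 0 by apply: pochhammer_neq0_le bn.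
  have e := pochhammer_shift b j.
  move: bj1; rewrite pochhammerSl mulf_eq0 negb_or => /andP[b0 b1j].
  have bj : pochhammer b j != 0 by apply: pochhammer_neq0_le bn; apply: leqW.
  have jf : j`!%:R != 0 :> K by rewrite pnatr_eq0 -lt0n fact_gt0.
  have -> : pochhammer (b + 1) j = pochhammer b j * (b + j%:R) / b.
    by rewrite -e mulrAC divff ?mul1r.
  have bj' : b + j%:R != 0.
    by apply: contra_neq (mulf_neq0 b0 b1j) => h; rewrite e h mulr0.
  by field; rewrite b0 bj bj' jf.
by rewrite !hornerE.
Qed.

(** * Differentiation and differences in z-coefficients *)

(** Coefficient form of the derivative of 2F1, which raises all three
    parameters.  The denominators of the two sides have the same factors in [b], so
    it does no harm if one of these vanishes. *)
Lemma hyp_coefS a x b j :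
  j.+1%:R * hyp_coef a x b j.+1
  = - (a * x / b) * hyp_coef (a + 1) (x - 1) (b + 1) j.
Proof.
rewrite /hyp_coef !pochhammerSl factS natrM opprB [- x + 1]addrC !invfM.
have : j.+1%:R != 0 :> K by rewrite pnatr_eq0.
move: j.+1%:R b^-1 (pochhammer (b + 1) j)^-1 j`!%:R^-1 => i u v w i0.
by field.
Qed.

(** Symmetry of 2F1 in its two numerator parameters, which exchanges the
    roles of the degree and of the argument. *)
Lemma hyp_coefC a x b j : hyp_coef a x b j = hyp_coef (- x) (- a) b j.
Proof. by rewrite /hyp_coef opprK [pochhammer a j * _]mulrC. Qed.

Lemma hyp_coef_diff a x b j :
  hyp_coef a x b j.+1 - hyp_coef (a + 1) x b j.+1
  = x / b * hyp_coef (a + 1) (x - 1) (b + 1) j.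
Proof.
rewrite /hyp_coef [pochhammer (a + 1) j.+1]pochhammerSr !pochhammerSl.
rewrite factS natrM opprB [- x + 1]addrC !invfM -natr1.
have : j%:R + 1 != 0 :> K by rewrite natr1 pnatr_eq0.
move: j%:R b^-1 (pochhammer (b + 1) j)^-1 j`!%:R^-1 => i u v w i0.
by field.
Qed.

Lemma hyp_coef0 a x b : hyp_coef a x b 0 = 1.
Proof. by rewrite /hyp_coef !pochhammer0 fact0 !mulr1 divr1. Qed.

Lemma meixner_poly_deriv n x b z :
  (P n x b)^`().[z] = n%:R * x / b * (P (n%:Z - 1) (x - 1) (b + 1)).[z].
Proof.
have /(congr1 (horner^~ z)) : (P n x b)^`() =
    (x / b) *: (n%:R *: P (n%:Z - 1) (x - 1) (b + 1)).
  apply/polyP => j; rewrite coef_deriv !coefZ coef_meixner_poly_pred.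
  rewrite coef_meixner_poly -[_ *+ j.+1]mulr_natl hyp_coefS [- n%:R + 1]addrC.
  by ring.
by rewrite !hornerZ => ->; ring.
Qed.

Lemma meixner_poly_diff_index n x b z :
  (P (n%:Z + 1) x b).[z] - (P n x b).[z]
  = x / b * (z * (P n (x - 1) (b + 1)).[z]).
Proof.
have -> : n%:Z + 1 = n.+1 by rewrite -PoszD addn1.
have /(congr1 (horner^~ z)) : P n.+1 x b - P n x b =
    (x / b) *: ('X * P n (x - 1) (b + 1)).
  apply/polyP => -[|j]; rewrite coefB coefZ coefXM !coef_meixner_poly /=.
    by rewrite !hyp_coef0 subrr mulr0.
  have -> : - n%:R = - n.+1%:R + 1 :> K by rewrite -natr1; ring.
  exact: hyp_coef_diff.
by rewrite !hornerE.
Qed.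

(** By the symmetry of 2F1 this is the difference in the index with the two
    numerator parameters exchanged. *)
Lemma meixner_poly_diff_x n x b z :
  (P n (x + 1) b).[z] - (P n x b).[z]
  = n%:R / b * (z * (P (n%:Z - 1) x (b + 1)).[z]).
Proof.
have /(congr1 (horner^~ z)) : P n (x + 1) b - P n x b =
    b^-1 *: ('X * (n%:R *: P (n%:Z - 1) x (b + 1))).
  apply/polyP => -[|j]; rewrite coefB coefZ coefXM !coef_meixner_poly /=.
    by rewrite !hyp_coef0 subrr mulr0.
  rewrite coefZ coef_meixner_poly_pred.
  rewrite [hyp_coef _ (x + 1) _ _]hyp_coefC [hyp_coef _ x b _]hyp_coefC.
  have -> : - x = - (x + 1) + 1 by ring.
  rewrite hyp_coef_diff [in RHS]hyp_coefC !opprK.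
  have -> : - (x + 1) + 1 = - x by ring.
  by rewrite opprB; ring.
by rewrite hornerD hornerN hornerZ hornerM hornerX hornerZ => ->; ring.
Qed.

(** * Contiguous relations *)

(** Eliminating the Euler operator between the shift of [b] and the shift of a
    numerator parameter. *)
Lemma meixner_poly_contiguous_x n x b z : pochhammer b n.+1 != 0 ->
  b * (P n x b).[z] + x * (P n (x - 1) (b + 1)).[z]
  = (x + b) * (P n x (b + 1)).[z].
Proof. by move=> bn; rewrite -euler_beta // -euler_x; ring. Qed.

Lemma meixner_poly_contiguous_index n x b z : pochhammer b n.+1 != 0 ->
  b * (P n x b).[z] + n%:R * (P (n%:Z - 1) x (b + 1)).[z]
  = (n%:R + b) * (P n x (b + 1)).[z].
Proof. by move=> bn; rewrite -euler_beta // -euler_index; ring. Qed.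

Lemma pochhammer_base_neq0 b n : pochhammer b n.+1 != 0 -> b != 0.
Proof. by rewrite pochhammerSl mulf_eq0 negb_or => /andP[]. Qed.

(** This first-order operator is what d/dc becomes on c^n (b)_n M_n, up to a
    factor.  The part [n - z d/dz] lowers the index, the remaining derivative
    lowers the index and the argument and raises [b], and the two results
    combine by the contiguous relation in [x]. *)
Lemma meixner_poly_lower n x b z : b != 0 -> pochhammer b n != 0 ->
  n%:R * (P n x b).[z] + (1 - z) * (P n x b)^`().[z]
  = n%:R * (x + b) / b * (P (n%:Z - 1) x (b + 1)).[z].
Proof.
move=> b0 bn.
have -> : n%:R * (P n x b).[z] + (1 - z) * (P n x b)^`().[z] =
    n%:R * (P (n%:Z - 1) x b).[z] + (P n x b)^`().[z].
  by rewrite -euler_index; ring.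
rewrite meixner_poly_deriv.
case: n bn => [|n] bn; first by rewrite !mul0r addr0.
have -> : n.+1%:Z - 1 = n by rewrite intS addrAC subrr add0r.
transitivity (n.+1%:R / b *
  (b * (P n x b).[z] + x * (P n (x - 1) (b + 1)).[z])); first by field.
by rewrite meixner_poly_contiguous_x //; ring.
Qed.

(** Going from index [n] to [n + 1] costs a term in M_n(x-1; b+1), and both this
    term and M_n(x; b) are Euler-operator images of M_n(x; b+1). *)
Lemma meixner_poly_raise n x b z : pochhammer b n.+1 != 0 ->
  b * (P (n%:Z + 1) x b).[z]
  = z * (1 - z) * (P n x (b + 1))^`().[z] + (z * x + b) * (P n x (b + 1)).[z].
Proof.
move=> bn; have b0 := pochhammer_base_neq0 bn.
have /eqP := meixner_poly_diff_index n x b z; rewrite subr_eq => /eqP ->.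
rewrite mulrDr -euler_beta //.
have -> : b * (x / b * (z * (P n (x - 1) (b + 1)).[z])) =
    z * (x * (P n (x - 1) (b + 1)).[z]) by field.
by rewrite -euler_x; ring.
Qed.

(** The only relation here that is of second order in nature.  Rather than the
    hypergeometric equation, the proof uses that, after the contiguous relation
    in the index, the right-hand side contains exactly the lowering formula
    for parameter [b + 1], while one difference in the index and one in the
    argument bring the left-hand side back to M_n(x; b+1) and its image under
    the Euler operator. *)
Lemma meixner_poly_raise2 n x b z : pochhammer b n.+2 != 0 ->
  b * (P (n%:Z + 1) (x + 1) b).[z]
  = (1 - z) * b * (P n x (b + 1)).[z]
    + z * (x + b + 1) * (b + 1 + n%:R) / (b + 1) * (P n x (b + 1 + 1)).[z].
Proof.
move=> bn2.
have bn : pochhammer b n.+1 != 0 by apply: pochhammer_neq0_le bn2.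
have b0 := pochhammer_base_neq0 bn.
move: (bn2); rewrite pochhammerSl mulf_eq0 negb_or => /andP[_ b1n].
have b10 := pochhammer_base_neq0 b1n.
have b1n' : pochhammer (b + 1) n != 0 by apply: pochhammer_neq0_le b1n.
have -> : z * (x + b + 1) * (b + 1 + n%:R) / (b + 1) * (P n x (b + 1 + 1)).[z]
  = z * (x + b + 1) / (b + 1) * ((n%:R + (b + 1)) * (P n x (b + 1 + 1)).[z]).
  by ring.
rewrite -meixner_poly_contiguous_index //.
have -> : z * (x + b + 1) / (b + 1) *
    ((b + 1) * (P n x (b + 1)).[z] + n%:R * (P (n%:Z - 1) x (b + 1 + 1)).[z])
  = z * (x + b + 1) * (P n x (b + 1)).[z] +
    z * (n%:R * (x + (b + 1)) / (b + 1) * (P (n%:Z - 1) x (b + 1 + 1)).[z]).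
  by field.
rewrite -meixner_poly_lower //.
have /eqP := meixner_poly_diff_index n (x + 1) b z; rewrite subr_eq addrK.
move=> /eqP ->.
have /eqP := meixner_poly_diff_x n x b z; rewrite subr_eq => /eqP ->.
have -> : b * ((x + 1) / b * (z * (P n x (b + 1)).[z]) +
    (n%:R / b * (z * (P (n%:Z - 1) x (b + 1)).[z]) + (P n x b).[z]))
  = (x + 1) * (z * (P n x (b + 1)).[z]) +
    z * (n%:R * (P (n%:Z - 1) x (b + 1)).[z]) + b * (P n x b).[z] by field.
by rewrite -euler_index -euler_beta //; ring.
Qed.

(** * The derivative with respect to c *)

(** The chain rule for t |-> 1 - 1/t followed by a polynomial, by induction on
    the polynomial so that only the product rule is involved and the field need
    not be real. *)
Lemma is_derive_horner_1BV (p : {poly K}) c : c != 0 ->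
  is_derive c 1 (fun t : K => p.[1 - 1 / t] : K^o) (p^`().[1 - 1 / c] / c ^+ 2).
Proof.
move=> c0; pose w : K -> K^o := fun t => 1 - 1 / t.
have dw : is_derive c 1 w (c ^- 2).
  have -> : w = (cst 1 - (fun t : K => t^-1 : K^o)).
    by apply/funext => t; rewrite /w div1r.
  have dV : is_derive c 1 (fun t : K => t^-1 : K^o) (- c ^- 2).
    apply: DeriveDef; first exact: (@derivableV K K^o id).
    by rewrite (@deriveV K K^o id) // derive_id scaler1.
  by apply: is_derive_eq; rewrite sub0r opprK.
elim/poly_ind: p => [|p r IHp].
  rewrite deriv0 horner0 mul0r.
  under eq_fun do rewrite horner0.
  exact: is_derive_cst.
have -> : (fun t : K => (p * 'X + r%:P).[1 - 1 / t] : K^o) =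
    (fun t => p.[1 - 1 / t] : K^o) * w + cst r.
  by apply/funext => t; rewrite hornerMXaddC.
apply: is_derive_eq.
rewrite addr0 derivD derivC addr0 derivM derivX mulr1 hornerD hornerM hornerX /w.
by rewrite /GRing.scale /=; ring.
Qed.

(** The factor 1/c produced by differentiating 1 - 1/c is written as 1 - z with
    z = 1 - 1/c, the form it takes in the lowering and raising formulas. *)
Lemma is_derive_scaled_meixner n x b c : c != 0 ->
  is_derive c 1 (scaled_meixner n x b)
    (c ^+ n * pochhammer b n / c *
      (n%:R * (P n x b).[1 - 1 / c]
       + (1 - (1 - 1 / c)) * (P n x b)^`().[1 - 1 / c])).
Proof.
move=> c0; have dP := is_derive_horner_1BV (P n x b) c0.
have -> : scaled_meixner n x b =
    ((id : K -> K^o) ^+ n * cst (pochhammer b n)) *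
    (fun t : K => (P n x b).[1 - 1 / t] : K^o).
  apply/funext => t.
  by rewrite /scaled_meixner meixnerE !fctE.
apply: is_derive_eq.
rewrite !fctE /cst /GRing.scale /= mulr0 add0r.
case: n {dP} => [|n]; first by rewrite expr0; field.
by rewrite [n.+1.-1]/= exprS; field.
Qed.

(** * Identities for the Meixner polynomials *)

Lemma meixner_add_fwd_diff n x b c :
  c != 0 -> c != 1 -> pochhammer b n.+1 != 0 ->
  meixner n x b c
    + c / (c - 1) * (meixner (n%:Z + 1) x b c - meixner n x b c)
  = (x + b) / b * meixner n x (b + 1) c.
Proof.
move=> c0 c1 bn; have b0 := pochhammer_base_neq0 bn.
have cB1 : c - 1 != 0 by rewrite subr_eq0.
rewrite !meixnerE meixner_poly_diff_index.
rewrite -[RHS]mulrAC -meixner_poly_contiguous_x //.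
by field; rewrite b0 c0 cB1.
Qed.

(** Common source of the two identities that raise the index and the argument
    together: they are this one at b = beta - 1 and b = beta - 2, with the
    term in b + 2, respectively the one in b + 1, expressed by a difference in
    beta. *)
Lemma meixner_raise2 n x b c :
  c != 0 -> c != 1 -> b + 1 + n%:R != 0 -> pochhammer b n.+1 != 0 ->
  (b + 1) * b * c / ((b + 1 + n%:R) * (c - 1)) * meixner (n%:Z + 1) (x + 1) b c
  = (b + 1) * b / ((b + 1 + n%:R) * (c - 1)) * meixner n x (b + 1) c
    + (x + b + 1) * meixner n x (b + 1 + 1) c.
Proof.
move=> c0 c1 bn0 bn; have cB1 : c - 1 != 0 by rewrite subr_eq0.
have bn2 : pochhammer b n.+2 != 0.
  by rewrite pochhammerSr mulf_neq0 // -natr1 addrA addrAC.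
have b10 : b + 1 != 0.
  move: bn2; rewrite pochhammerSl mulf_eq0 negb_or => /andP[_].
  exact: pochhammer_base_neq0.
rewrite !meixnerE.
have -> : (b + 1) * b * c / ((b + 1 + n%:R) * (c - 1)) *
    (meixner_poly (n%:Z + 1) (x + 1) b).[1 - 1 / c]
  = (b + 1) * c / ((b + 1 + n%:R) * (c - 1)) *
    (b * (meixner_poly (n%:Z + 1) (x + 1) b).[1 - 1 / c]) by ring.
rewrite meixner_poly_raise2 //.
by field; rewrite c0 cB1 b10 bn0.
Qed.

End MeixnerPoly.

Theorem lemma4p9 (R : realType) (x beta c : R[i]) (n : nat) :
  beta != 0 -> beta != 2 -> c != 0 -> c != 1 ->
  (meixner_defined n%:Z beta -> meixner_defined (n%:Z + 1) beta ->
   meixner_defined n%:Z (beta + 1) ->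
     beta * c / (c - 1) * fwd_diff (fun m : int => meixner m x beta c) n%:Z
     = x * meixner n%:Z (x - 1) (beta + 1) c)
  /\
  (meixner_defined n%:Z beta -> meixner_defined (n%:Z + 1) beta ->
   meixner_defined n%:Z (beta + 1) ->
     meixner n%:Z x beta c
       + c / (c - 1) * fwd_diff (fun m : int => meixner m x beta c) n%:Z
     = (x + beta) / beta * meixner n%:Z x (beta + 1) c)
  /\
  ((0 < n)%N ->
   meixner_defined n%:Z beta -> meixner_defined (n%:Z - 1) beta ->
   meixner_defined (n%:Z - 1) (beta + 1) ->
     meixner n%:Z x beta c
       + 1 / (c - 1) * bwd_diff (fun m : int => meixner m x beta c) n%:Z
     = (x + beta) / beta * meixner (n%:Z - 1) x (beta + 1) c)
  /\
  (meixner_defined n%:Z beta -> meixner_defined n%:Z (beta - 1) ->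
   meixner_defined (n%:Z - 1) (beta + 1) ->
     c * beta * (1 - beta) / (c - 1)
       * bwd_diff (fun b => meixner n%:Z x b c) beta
     = x * n%:R * meixner (n%:Z - 1) (x - 1) (beta + 1) c)
  /\
  (beta + n%:R != 0 ->
   meixner_defined (n%:Z + 1) (beta - 1) -> meixner_defined n%:Z beta ->
   meixner_defined n%:Z (beta + 1) ->
     beta * (beta - 1) * c / ((beta + n%:R) * (c - 1))
       * meixner (n%:Z + 1) (x + 1) (beta - 1) c
     = (x + beta + beta * (beta - 1) / ((beta + n%:R) * (c - 1)))
         * meixner n%:Z x beta c
       + (x + beta) * fwd_diff (fun b => meixner n%:Z x b c) beta)
  /\
  (beta - 1 + n%:R != 0 ->
   meixner_defined (n%:Z + 1) (beta - 2) -> meixner_defined n%:Z beta ->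
   meixner_defined n%:Z (beta - 1) ->
     (beta - 1) * (beta - 2) * c / ((beta - 1 + n%:R) * (c - 1))
       * meixner (n%:Z + 1) (x + 1) (beta - 2) c
     = (x + beta - 1
          + (beta - 1) * (beta - 2) / ((beta - 1 + n%:R) * (c - 1)))
         * meixner n%:Z x beta c
       - (beta - 1) * (beta - 2) / ((beta - 1 + n%:R) * (c - 1))
         * bwd_diff (fun b => meixner n%:Z x b c) beta)
  /\
  (n%:R + beta != 0 ->
   meixner_defined n%:Z beta -> meixner_defined (n%:Z - 1) (beta + 1) ->
     derivable (scaled_meixner n x beta) c 1 /\
     derive1 (scaled_meixner n x beta) c
     = n%:R * (x + beta) / (c * (n%:R + beta))
       * c ^+ n * pochhammer (beta + 1) n
       * meixner (n%:Z - 1) x (beta + 1) c)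
  /\
  (meixner_defined n%:Z beta -> meixner_defined (n%:Z + 1) (beta - 1) ->
     derivable (scaled_meixner n x beta) c 1 /\
     c * (1 - beta) * c ^+ n * pochhammer beta n * beta
       * meixner (n%:Z + 1) x (beta - 1) c
     = c * (1 - c) * beta * derive1 (scaled_meixner n x beta) c
       - ((c - 1) * x + n%:R - (n%:R + 1) * c + c * beta)
         * c ^+ n * pochhammer beta n * beta * meixner n%:Z x beta c).
Proof.
move=> b0 b2 c0 c1.
have cB1 : c - 1 != 0 by rewrite subr_eq0.
have predS (m : nat) : m.+1%:Z - 1 = m by rewrite intS addrAC subrr add0r.
have succ (m : nat) : m%:Z + 1 = m.+1 by rewrite -PoszD addn1.
split=> [_ _ _|].
  rewrite /fwd_diff !meixnerE meixner_poly_diff_index.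
  by field; rewrite c0 cB1 b0.
split=> [_|].
  by rewrite succ => /meixner_defined_pochhammer bn _; exact: meixner_add_fwd_diff.
split=> [n0 bn _ _|].
  case: n n0 bn => // m _ /meixner_defined_pochhammer bm; rewrite /bwd_diff predS.
  by rewrite -meixner_add_fwd_diff // succ; field.
split=> [bn bn1 _|].
  rewrite /bwd_diff !meixnerE.
  (* For n = 0 the hypotheses allow beta = 1, where the shift from beta - 1 to
     beta breaks down, but both polynomials are then constant. *)
  case: n bn bn1 => [|m] bn.
    move=> _; rewrite !horner_poly !big_ord1 /hyp_coef !pochhammer0.
    by rewrite subrr !mulr0 !mul0r.
  move=> /meixner_defined_pochhammer bm; have bB1 := pochhammer_base_neq0 bm.
  have bm1 : pochhammer (beta - 1) m.+2 != 0.
    by rewrite pochhammerSl subrK mulf_neq0 //; exact: meixner_defined_pochhammer.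
  have := euler_beta x (1 - 1 / c) bm1.
  rewrite subrK meixner_poly_deriv => e.
  have -> : (meixner_poly m.+1 x (beta - 1)).[1 - 1 / c] =
    ((beta - 1) * (meixner_poly m.+1 x (beta - 1)).[1 - 1 / c]) / (beta - 1).
    by field.
  by rewrite -e; field; rewrite c0 cB1 b0 bB1.
split=> [bn0|].
  rewrite succ => /meixner_defined_pochhammer bn _ _.
  have := @meixner_raise2 _ n x (beta - 1) c c0 c1.
  rewrite succ subrK => /(_ bn0 bn) ->; rewrite /fwd_diff.
  by move: (meixner _ _ beta _) (meixner _ _ (beta + 1) _) => u v; ring.
split=> [bn0|].
  rewrite succ => /meixner_defined_pochhammer bn _ _.
  have := @meixner_raise2 _ n x (beta - 2) c c0 c1.
  have -> : beta - 2 + 1 = beta - 1 by ring.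
  rewrite succ subrK => /(_ bn0 bn) ->; rewrite /bwd_diff.
  by move: (meixner _ _ beta _) (meixner _ _ (beta - 1) _) => u v; ring.
have dS := is_derive_scaled_meixner n x beta c0.
split=> [bn0 bn _|bn].
  split; first exact: ex_derive.
  rewrite derive1E derive_val meixnerE.
  rewrite meixner_poly_lower //; last exact: bn.
  have -> : pochhammer (beta + 1) n = pochhammer beta n * (beta + n%:R) / beta.
    by rewrite -pochhammer_shift mulrAC divff ?mul1r.
  by field; rewrite c0 b0 bn0.
rewrite succ => /meixner_defined_pochhammer bn1; split; first exact: ex_derive.
rewrite derive1E derive_val !meixnerE -succ.
have := meixner_poly_raise x (1 - 1 / c) bn1; rewrite subrK => e.
have -> : c * (1 - beta) * c ^+ n * pochhammer beta n * beta *
    (meixner_poly (n%:Z + 1) x (beta - 1)).[1 - 1 / c] =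
  - (c * c ^+ n * pochhammer beta n * beta) * ((beta - 1) *
    (meixner_poly (n%:Z + 1) x (beta - 1)).[1 - 1 / c]) by ring.
by rewrite e; field.
Qed.
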